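(* Out of all rooted ordered binary trees $T$ of size $k$, the trees for which $\mathbb{P}(\mathrm{DTCS}(k)=T)$ is minimal are the orderings of $\mathrm{Cat}(k)$, with $$\mathbb{P}(\mathrm{DTCS}(k)=\mathrm{Cat}(k))=k\,2^{-k+1}\prod_{i=2}^k\frac{1}{h_{i-1}}=\exp\big(-(1+o(1))\,k\log\log k\big),$$ where the last equality is as $k\to\infty$.
   Context: Binary trees are rooted full binary trees: every internal vertex has exactly two children. The size of a tree is its number of leaves. Ordered trees (plane trees) are trees in which the left and right subtrees of each internal vertex are distinguished; $T=T'$ means identical as rooted ordered trees, and $T\cong T'$ means identical as rooted unordered trees. An ordering of a rooted binary tree $T$ is any rooted ordered tree $T'$ with $T'\cong T$. For $m\ge 2$ let $h_{m-1}=\sum_{j=1}^{m-1}1/j$ and let $q_m$ be the probability distribution on $\{1,\dots,m-1\}$ given by $$q_m(i)=\frac{m}{2h_{m-1}}\,\frac{1}{i(m-i)}.$$ The discrete-time critical beta-splitting tree $\mathrm{DTCS}(n)$ is the random rooted ordered binary tree with $n$ leaves built as follows: split $[n]=\{1,\dots,n\}$ into a left subtree on $\{1,\dots,L_n\}$ and a right subtree on $\{L_n+1,\dots,n\}$, where $L_n$ has distribution $q_n$; then recursively and independently split each interval of size $m\ge2$ into left and right parts according to $q_m$, stopping at intervals of size $m=1$ (the leaves). Leaf labels are disregarded when comparing shapes. $\mathrm{Cat}(k)$ (the caterpillar tree) is the rooted ordered binary tree of size $k$ in which all splits are of size $1$: each internal vertex has a leaf as its left child, and its right subtree is the caterpillar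 on the remaining leaves ($\mathrm{Cat}(1)$ is a single leaf). $\log$ is the natural logarithm. *)

(* Defs.v *)
From HB Require Import structures.
From mathcomp Require Import all_boot all_order all_algebra ring.
From mathcomp Require Import all_classical all_reals all_analysis giry.

Set Implicit Arguments.
Unset Strict Implicit.
Unset Printing Implicit Defensive.

Import Order.TTheory GRing.Theory Num.Theory.
Import numFieldNormedType.Exports.

Local Open Scope classical_set_scope.
Local Open Scope ring_scope.

Inductive tree : Type :=
| Leaf : tree
| Node : tree -> tree -> tree.

Fixpoint tree_size (t : tree) : nat :=
  if t is Node l r then (tree_size l + tree_size r)%N else 1%N.

(** [tree_iso t t'] is equality of the underlying rooted unordered trees: the
    children of any internal vertex may be swapped. *)
Inductive tree_iso : tree -> tree -> Prop :=
| iso_leaf : tree_iso Leaf Leaf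
| iso_node l r l' r' :
    tree_iso l l' -> tree_iso r r' -> tree_iso (Node l r) (Node l' r')
| iso_swap l r l' r' :
    tree_iso l r' -> tree_iso r l' -> tree_iso (Node l r) (Node l' r').

(** [caterpillar 1 = Leaf] and [caterpillar k.+2 = Node Leaf (caterpillar k.+1)];
    the value at [0] is junk, no tree having size [0]. *)
Definition caterpillar (k : nat) : tree := iter k.-1 (Node Leaf) Leaf.

Fixpoint tree_encode (t : tree) : GenTree.tree void :=
  if t is Node l r then GenTree.Node 1 [:: tree_encode l; tree_encode r]
  else GenTree.Node 0 [::].

Fixpoint tree_decode (s : GenTree.tree void) : tree :=
  if s is GenTree.Node _ [:: l; r] then Node (tree_decode l) (tree_decode r)
  else Leaf.

Lemma tree_encodeK : cancel tree_encode tree_decode.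
Proof. by elim=> [//|l IHl r IHr] /=; rewrite IHl IHr. Qed.

HB.instance Definition _ := Countable.copy tree (can_type tree_encodeK).
HB.instance Definition _ := isPointed.Build tree Leaf.
HB.instance Definition _ := @isMeasurable.Build default_measure_display
  tree discrete_measurable discrete_measurable0
  discrete_measurableC discrete_measurableU.

Lemma measurable_Node :
  measurable_fun [set: tree * tree] (fun p => Node p.1 p.2).
Proof.
move=> _ Y _; rewrite setTI; apply: countable_measurable; last first.
  exact: (@countableP (tree * tree)%type).
move=> p; have -> : [set p] = [set p.1] `*` [set p.2].
  by apply/seteqP; split => [_ ->//|[a b] [/= -> ->]]; case: p.
exact: measurableX.
Qed.

Definition harmonic_sum (R : realType) (n : nat) : R :=
  \sum_(1 <= j < n.+1) j%:R^-1.

Section split.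
Context {R : realType}.

Definition split_pmf (m i : nat) : R :=
  if (0 < i < m)%N
  then m%:R / (2 * harmonic_sum R m.-1) * (i%:R * (m - i)%:R)^-1
  else 0.

Lemma harmonic_sum_ge0 n : 0 <= harmonic_sum R n.
Proof. by apply: sumr_ge0 => j _; rewrite invr_ge0. Qed.

Lemma harmonic_sum_gt0 n : (0 < n)%N -> 0 < harmonic_sum R n.
Proof.
move=> n0; rewrite /harmonic_sum big_ltn// invr1 ltr_pwDl//.
by apply: sumr_ge0 => j _; rewrite invr_ge0.
Qed.

Lemma split_pmf_ge0 m i : 0 <= split_pmf m i.
Proof.
rewrite /split_pmf; case: ifP => // _.
by rewrite mulr_ge0 ?invr_ge0 ?mulr_ge0 ?invr_ge0// mulr_ge0// harmonic_sum_ge0.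
Qed.

Lemma sum_split_pmf m : (1 < m)%N -> \sum_(1 <= i < m) split_pmf m i = 1.
Proof.
move=> m1.
have h0 : harmonic_sum R m.-1 != 0.
  by rewrite gt_eqF// harmonic_sum_gt0// -ltnS prednK// ltnW.
have m0 : (0 < m)%N by exact: ltnW.
transitivity (\sum_(1 <= i < m)
    (2 * harmonic_sum R m.-1)^-1 * (i%:R^-1 + (m - i)%:R^-1) : R).
  apply: eq_big_nat => i /andP[i0 im]; rewrite /split_pmf i0 im/=.
  have i0' : i%:R != 0 :> R by rewrite pnatr_eq0 -lt0n.
  have mi0 : (m - i)%:R != 0 :> R by rewrite pnatr_eq0 subn_eq0 -ltnNge.
  have -> : m%:R = i%:R + (m - i)%:R :> R by rewrite -natrD subnKC// ltnW.
  by field; rewrite h0 mi0 i0'.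
rewrite -big_distrr/= big_split/=.
rewrite [X in _ + X]big_nat_rev/=.
rewrite (_ : \sum_(1 <= i < m) i%:R^-1 = harmonic_sum R m.-1); last first.
  by rewrite /harmonic_sum prednK.
rewrite (_ : \sum_(1 <= i < m) _ = harmonic_sum R m.-1); last first.
  rewrite /harmonic_sum prednK//; apply: eq_big_nat => i /andP[i0 im].
  by rewrite add1n subSS subKn// ltnW.
by field.
Qed.

(** The law [q_m]; it is only meaningful for [2 <= m]. *)
Definition split_prob (m : nat) : set nat -> \bar R :=
  fun U => if (1 < m)%N then \esum_(i in U) (split_pmf m i)%:E else \d_1%N U.

Section split_prob.
Variable m : nat.
Local Open Scope ereal_scope.

Local Notation split := (split_prob m).

Let split0 : split set0 = 0.
Proof. by rewrite /split_prob measure0; case: ifPn => //; rewrite esum_set0. Qed.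

Let split_ge0 U : 0 <= split U.
Proof.
rewrite /split_prob; case: ifPn => // _; apply: esum_ge0 => i _.
by rewrite lee_fin split_pmf_ge0.
Qed.

Let split_sigma_additive : semi_sigma_additive split.
Proof.
move=> F mF tF mUF; rewrite /split_prob; case: ifPn => m1; last first.
  exact: measure_semi_sigma_additive.
apply: cvg_toP.
  apply: ereal_nondecreasing_is_cvgn => a b ab.
  apply: lee_sum_nneg_natr => // k _ _.
  by apply: esum_ge0 => i _; rewrite lee_fin split_pmf_ge0.
by rewrite nneseries_sum_bigcup// => i; rewrite lee_fin split_pmf_ge0.
Qed.

HB.instance Definition _ := isMeasure.Build _ _ _ split
  split0 split_ge0 split_sigma_additive.

Let split_setT : split [set: _] = 1.
Proof.
rewrite /split_prob; case: ifPn => m1; last by rewrite diracT.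
rewrite (esumID `I_m)//; last by move=> i _; rewrite lee_fin split_pmf_ge0.
rewrite [X in _ + X]esum1 ?adde0; last first.
  move=> i [_ /negP]; rewrite /= -leqNgt => mi.
  by rewrite /split_pmf [(i < m)%N]ltnNge mi andbF.
rewrite setTI esum_fset//; last by move=> i _; rewrite lee_fin split_pmf_ge0.
rewrite -fsbig_ord//= sumEFin -(big_mkord xpredT (split_pmf m)).
by rewrite big_ltn 1?ltnW// sum_split_pmf// /split_pmf ltnn add0r.
Qed.

HB.instance Definition _ :=
  @Measure_isProbability.Build _ _ R split split_setT.

End split_prob.

Lemma measurable_from_nat d (T : measurableType d) (f : nat -> T) :
  measurable_fun [set: nat] f.
Proof. by []. Qed.

(** The law of the tree built on an interval of size [m]: the size [i] of the
    left part has law [q_m] and, given [i], the two subtrees are independent.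
    [fuel] bounds the depth of the recursion; any [fuel >= m.-1] will do. *)
Fixpoint dtcs_rec (fuel m : nat) : giry tree R :=
  if fuel is fuel'.+1 then
    if (m <= 1)%N then giry_ret Leaf
    else giry_bind (split_prob m) (measurable_from_nat (fun i =>
           giry_map measurable_Node
             (giry_prod (dtcs_rec fuel' i, dtcs_rec fuel' (m - i)%N))))
  else giry_ret Leaf.

(** The law of DTCS(n) on shapes: leaf labels are disregarded, so an interval
    enters the recursion only through its size. *)
Definition dtcs (n : nat) : set tree -> \bar R := dtcs_rec n n.

Section dtcs.
Variable n : nat.

HB.instance Definition _ := SubProbability.on (dtcs n).

Let dtcs_setT : dtcs n [set: tree] = 1%E.
Proof.
suff H N m : dtcs_rec N m [set: tree] = 1%E by exact: H.
elim: N m => [|N IH] m /=; first by rewrite /giry_ret /= /dirac indicT.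
case: ifP => _; first by rewrite /giry_ret /= /dirac indicT.
set f := fun i : nat => giry_map _ _; rewrite /giry_bind/=.
transitivity (\int[split_prob m]_i (f i) [set: tree])%E.
  by apply: giry_int_map => //; exact: measurable_giry_ev.
rewrite (eq_integral (cst 1%E)) => [|i _].
  by rewrite integral_cst// mul1e [LHS]probability_setT.
transitivity (giry_prod (dtcs_rec N i, dtcs_rec N (m - i)) (setT `*` setT)).
  by rewrite setXTT.
by rewrite [LHS]product_measure1E//= !IH mule1.
Qed.

HB.instance Definition _ :=
  @Measure_isProbability.Build _ _ R (dtcs n) dtcs_setT.
End dtcs.

End split.

(* Main.v *)
(** Write [H n] for the product of [h_j] over [1 <= j < n].  The factors
    [m / (i (m - i))] of a tree of size [k] telescope to [k], so each tree has
    probability [k 2^(1-k)] times the product of [1 / h_(m-1)] over the sizes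
    [m >= 2] of its subtrees.  Since [h] is increasing,
    [H a * H b <= H (a + b - 1)], strictly unless [a = 1] or [b = 1]; hence, by
    induction on the tree, replacing both subtrees by caterpillars and merging
    them into one caterpillar only lowers the probability.
    For the asymptotics, [log (n + 1) <= h_n <= 1 + log n], and bounding [h_j]
    from below only for [j >= sqrt k] gives [log (H k) = k log log k + O(k)]. *)
Require Import Defs.
From mathcomp Require Import all_boot all_order all_algebra.
From mathcomp Require Import all_classical all_reals all_analysis.
From mathcomp Require Import giry ring lra.

Import Order.TTheory GRing.Theory Num.Theory.
Import numFieldNormedType.Exports.
Local Open Scope classical_set_scope.
Local Open Scope ring_scope.

(** * Point masses of [dtcs] as products of split probabilities *)

Fixpoint tree_prob (R : realType) (t : tree) : R :=
  if t is Node l r then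
    split_pmf (R := R) (tree_size l + tree_size r) (tree_size l) *
      (tree_prob R l * tree_prob R r)
  else 1.

Lemma tree_size_gt0 (t : tree) : (0 < tree_size t)%N.
Proof. by elim: t => //= l l0 r _; rewrite addn_gt0 l0. Qed.

Lemma tree_size_eq1 (t : tree) : tree_size t = 1%N -> t = Leaf.
Proof.
case: t => //= l r; have := tree_size_gt0 l; have := tree_size_gt0 r.
by case: (tree_size l) (tree_size r) => [//|a] [//|b]; rewrite addSn addnS.
Qed.

Lemma tree_prob_ge0 (R : realType) (t : tree) : 0 <= tree_prob R t.
Proof. by elim: t => //= l l0 r r0; rewrite !mulr_ge0// split_pmf_ge0. Qed.

Lemma split_prob_set1 (R : realType) (m i : nat) : (1 < m)%N ->
  split_prob (R := R) m [set i] = (split_pmf m i)%:E.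
Proof.
by move=> m1; rewrite /split_prob m1 esum_set1// lee_fin split_pmf_ge0.
Qed.

(** Lets the integral over [i] in [dtcs_rec_set1] be restricted to sizes at which the induction
    hypothesis applies. *)
Lemma split_prob_ae (R : realType) (m : nat) : (1 < m)%N ->
  {ae split_prob (R := R) m, forall i, (0 < i < m)%N}.
Proof.
move=> m1; exists (~` [set i | (0 < i < m)%N]); split => //.
rewrite /split_prob m1; apply: esum1 => i /negP im.
by rewrite /split_pmf (negbTE im).
Qed.

Lemma giry_ret_Leaf_set1 (R : realType) (t : tree) :
  (giry_ret Leaf : giry tree R) [set t] =
  (if tree_size t == 1%N then tree_prob R t else 0)%:E.
Proof.
rewrite /giry_ret /= /dirac indicE; case: eqP => [/tree_size_eq1 ->|t1].
  by rewrite mem_set.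
by rewrite memNset// => tL; apply: t1; rewrite -tL.
Qed.

(** Induction on the fuel. A singleton [Node l r] pulls back to a rectangle of singletons, on which
    the product measure factors. Trees of the wrong size are covered with value 0, because the
    integral runs over every left size [i], not only [tree_size l]. *)
Lemma dtcs_rec_set1 (R : realType) (fuel m : nat) (t : tree) :
  (0 < m)%N -> (m <= fuel.+1)%N ->
  dtcs_rec (R := R) fuel m [set t] =
  (if tree_size t == m then tree_prob R t else 0)%:E.
Proof.
elim: fuel m t => [|fuel IH] m t m0 mf /=.
  have -> : m = 1%N by apply/eqP; rewrite eqn_leq mf m0.
  exact: giry_ret_Leaf_set1.
case: leqP => m1.
  have -> : m = 1%N by apply/eqP; rewrite eqn_leq m1 m0.
  exact: giry_ret_Leaf_set1.
set f := fun i : nat => giry_map _ _; rewrite /giry_bind/=.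
transitivity (\int[split_prob m]_i (f i) [set t])%E.
  by apply: giry_int_map => //; exact: measurable_giry_ev.
case: t => [|l r].
  transitivity (\int[split_prob (R := R) m]_i 0)%E; last first.
    by rewrite integral0 /=; case: eqP m1 => // <-.
  apply: eq_integral => i _; rewrite /f/= /giry_map/= /pushforward.
  by rewrite (_ : _ @^-1` _ = set0) ?measure0//; apply/seteqP; split.
(* The integrand is almost everywhere [c] times the indicator of [i = tree_size l]: for that [i],
   the right part has size [tree_size r] exactly when the total size is [m]. *)
pose c := if (tree_size l + tree_size r == m)%N
  then tree_prob R l * tree_prob R r else 0.
have c0 : 0 <= c.
  by rewrite /c; case: ifP => // _; rewrite mulr_ge0// tree_prob_ge0.
transitivity (\int[split_prob (R := R) m]_i
   (c%:E * (\1_[set tree_size l] i)%:E))%E; last first.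
  rewrite ge0_integralZl//.
  rewrite integral_indic// setIT.
  transitivity (c%:E * split_prob (R := R) m [set tree_size l])%E; first by [].
  rewrite split_prob_set1// -EFinM /c/=; congr EFin.
  by case: eqP => [->|_]; rewrite ?mul0r// mulrC.
apply: ge0_ae_eq_integral => //.
  by move=> i _; rewrite mule_ge0 ?lee_fin.
have : {ae split_prob (R := R) m, forall i, (0 < i < m)%N}
  by exact: split_prob_ae.
apply: filterS => i /andP[i0 im] _.
rewrite /f/= /giry_map/= /pushforward.
rewrite (_ : _ @^-1` _ = [set l] `*` [set r]); last first.
  by apply/seteqP; split => [[a b]/= [-> ->]//|[a b]/= [-> ->]].
rewrite [LHS]product_measure1E//= !IH ?subn_gt0//; last 2 first.
- by rewrite leq_subLR (leq_trans mf)// -addn1 addnC leq_add.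
- by rewrite -ltnS (leq_trans im).
rewrite -!EFinM indicE; congr EFin; rewrite /c.
case: eqP im => [<-|li] im; last by rewrite mul0r memNset ?mulr0// => /esym.
rewrite mem_set// mulr1.
rewrite -(eqn_add2l (tree_size l) (tree_size r)) subnKC 1?ltnW//.
by case: ifP => //; rewrite mulr0.
Qed.

(** * Harmonic products and caterpillar probabilities *)

Definition harmonic_prod (R : realType) (n : nat) : R :=
  \prod_(1 <= j < n) harmonic_sum R j.

Definition cat_prob (R : realType) (k : nat) : R :=
  k%:R * 2 ^- k.-1 * \prod_(2 <= i < k.+1) (harmonic_sum R i.-1)^-1.

Lemma harmonic_sumS (R : realType) (n : nat) :
  harmonic_sum R n.+1 = harmonic_sum R n + n.+1%:R^-1.
Proof. by rewrite /harmonic_sum big_nat_recr. Qed.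

Lemma ltr_harmonic_sum (R : realType) :
  {homo harmonic_sum R : m n / (m < n)%N >-> m < n}.
Proof.
apply: homo_ltn => [y x z|m]; first exact: lt_trans.
by rewrite harmonic_sumS ltrDl invr_gt0.
Qed.

Lemma ler_harmonic_sum (R : realType) :
  {homo harmonic_sum R : m n / (m <= n)%N >-> m <= n}.
Proof.
move=> m n; rewrite leq_eqVlt => /predU1P[->//|mn].
by rewrite ltW// ltr_harmonic_sum.
Qed.

Lemma harmonic_prod_gt0 (R : realType) (n : nat) : 0 < harmonic_prod R n.
Proof.
rewrite /harmonic_prod big_nat_cond prodr_gt0// => i /andP[/andP[i0 _] _].
exact: harmonic_sum_gt0.
Qed.

Lemma harmonic_prod1 (R : realType) : harmonic_prod R 1 = 1.
Proof. by rewrite /harmonic_prod big_geq. Qed.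

Lemma harmonic_prodS (R : realType) (n : nat) :
  harmonic_prod R n.+2 = harmonic_prod R n.+1 * harmonic_sum R n.+1.
Proof. by rewrite /harmonic_prod big_nat_recr. Qed.

(** Peel off the last factors: [h_b] on the left faces [h_(a+b)] on the right. When [a] and [b] are
    both positive, this last comparison alone is already strict. *)
Lemma harmonic_prodD (R : realType) (a b : nat) :
  harmonic_prod R a.+1 * harmonic_prod R b.+1 <= harmonic_prod R (a + b).+1
  ?= iff ((a == 0) || (b == 0))%N.
Proof.
have le a' b' : harmonic_prod R a'.+1 * harmonic_prod R b'.+1 <=
    harmonic_prod R (a' + b').+1.
  elim: b' => [|b' IH]; first by rewrite harmonic_prod1 mulr1 addn0.
  rewrite addnS !harmonic_prodS mulrA; apply: ler_pM => //.
  - by rewrite mulr_ge0// ltW// ?harmonic_prod_gt0.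
  - exact: harmonic_sum_ge0.
  - by rewrite ler_harmonic_sum// ltnS leq_addl.
apply/leifP; case: a => [|a]; first by rewrite /= harmonic_prod1 mul1r.
case: b => [|b]; first by rewrite /= harmonic_prod1 mulr1 addn0.
rewrite /= addnS (harmonic_prodS R b) mulrA.
rewrite (@le_lt_trans _ _ (harmonic_prod R (a.+1 + b).+1 * harmonic_sum R b.+1))//.
  by rewrite ler_pM2r// harmonic_sum_gt0.
rewrite (harmonic_prodS R (a.+1 + b)) ltr_pM2l ?harmonic_prod_gt0//.
by rewrite ltr_harmonic_sum// ltnS addSn ltnS leq_addl.
Qed.

Lemma cat_probE (R : realType) (k : nat) :
  cat_prob R k = k%:R / (2 ^+ k.-1 * harmonic_prod R k).
Proof.
rewrite /cat_prob /harmonic_prod invfM mulrA -prodfV; congr (_ * _).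
by rewrite big_add1.
Qed.

Lemma cat_prob_gt0 (R : realType) (k : nat) : (0 < k)%N -> 0 < cat_prob R k.
Proof.
move=> k0; rewrite cat_probE divr_gt0 ?ltr0n// mulr_gt0 ?exprn_gt0//.
exact: harmonic_prod_gt0.
Qed.

Lemma split_pmf_gt0 (R : realType) (a b : nat) : (0 < a)%N -> (0 < b)%N ->
  0 < split_pmf (R := R) (a + b) a.
Proof.
move=> a0 b0; rewrite /split_pmf a0 -[X in (X < _)%N]addn0 ltn_add2l b0/= addKn.
rewrite mulr_gt0 ?invr_gt0 ?mulr_gt0 ?ltr0n// ?addn_gt0 ?a0//.
rewrite invr_gt0 mulr_gt0// harmonic_sum_gt0//.
by case: a a0 => // a _; case: b b0 => // b _; rewrite addSn addnS.
Qed.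

Lemma split_pmfC (R : realType) (a b : nat) :
  split_pmf (R := R) (a + b) a = split_pmf (b + a) b.
Proof.
rewrite /split_pmf addKn -[X in (_ < X < _)%N]addn0 ltn_add2l.
rewrite -[X in (_ < X < b + a)%N]addn0 ltn_add2l !addn0.
by rewrite addKn (addnC b) (mulrC a%:R) andbC.
Qed.

(** The sizes in the split probability cancel those of the two caterpillars, the powers of 2
    combine, and the harmonic number of the root is the last factor of the merged product. Only a
    ratio of harmonic products remains, to be compared with 1 by [harmonic_prodD]. *)
Lemma cat_probD (R : realType) (a b : nat) :
  split_pmf (a.+1 + b.+1) a.+1 * (cat_prob R a.+1 * cat_prob R b.+1) =
  cat_prob R (a.+1 + b.+1) * (harmonic_prod R (a + b).+1 /
    (harmonic_prod R a.+1 * harmonic_prod R b.+1)).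
Proof.
rewrite !cat_probE /split_pmf addKn -[X in (_ < X < _)%N]addn0 ltn_add2l/=.
rewrite addSn addnS /= harmonic_prodS exprS exprD.
have := harmonic_prod_gt0 R a.+1; have := harmonic_prod_gt0 R b.+1.
have := harmonic_prod_gt0 R (a + b).+1.
have := @harmonic_sum_gt0 R _ (ltn0Sn (a + b)).
move: (harmonic_prod _ _) (harmonic_prod _ _) (harmonic_prod _ _).
move: (harmonic_sum _ _) => h p q r h0 p0 q0 r0.
field.
by rewrite !expf_neq0// !nat1r !gt_eqF.
Qed.

Lemma cat_probD_le (R : realType) (a b : nat) : (0 < a)%N -> (0 < b)%N ->
  cat_prob R (a + b) <= split_pmf (a + b) a * (cat_prob R a * cat_prob R b)
  ?= iff ((a == 1) || (b == 1))%N.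
Proof.
case: a => // a _; case: b => // b _; rewrite cat_probD !eqSS.
have ab0 : 0 < harmonic_prod R a.+1 * harmonic_prod R b.+1.
  by rewrite mulr_gt0 ?harmonic_prod_gt0.
have c0 : 0 < cat_prob R (a.+1 + b.+1) by rewrite cat_prob_gt0.
have [le eq] := harmonic_prodD R a b; rewrite -eq; split.
  by rewrite ler_pMr// ler_pdivlMr// mul1r.
rewrite -[X in X == _]mulr1 (inj_eq (mulfI (lt0r_neq0 c0))) eq_sym.
by rewrite -(inj_eq (mulIf (lt0r_neq0 ab0))) divfK ?lt0r_neq0// mul1r eq_sym.
Qed.

Lemma tree_size_caterpillar (k : nat) : tree_size (caterpillar k.+1) = k.+1.
Proof. by elim: k => //= k; rewrite /caterpillar /= => ->. Qed.

Lemma tree_prob_caterpillar (R : realType) (k : nat) :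
  tree_prob R (caterpillar k.+1) = cat_prob R k.+1.
Proof.
elim: k => [|k IH].
  by rewrite cat_probE harmonic_prod1 /= !mulr1 expr0 divr1.
rewrite (_ : caterpillar k.+2 = Node Leaf (caterpillar k.+1))//= IH.
rewrite tree_size_caterpillar.
(* The recursion for caterpillars is the equality case with a left part of size 1. *)
have [_] := cat_probD_le R 1 k.+1 erefl erefl.
rewrite eqxx => /eqP ->; congr (_ * (_ * _)).
by rewrite cat_probE harmonic_prod1 /= expr0 mulr1 divr1.
Qed.

(** * Minimal trees *)

Lemma tree_iso_prob (R : realType) (t t' : tree) : tree_iso t t' ->
  tree_size t = tree_size t' /\ tree_prob R t = tree_prob R t'.
Proof.
elim=> {t t'} [//|l r l' r' _ [sl pl] _ [sr pr]|l r l' r' _ [sl pl] _ [sr pr]] /=;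
  rewrite sl sr pl pr//; split; first exact: addnC.
by rewrite split_pmfC (mulrC (tree_prob R r')).
Qed.

(** Both claims go through one induction, since the equality case needs the lower bounds for the
    subtrees. The converse of the second claim comes from [tree_iso_prob]. *)
Lemma tree_prob_ge (R : realType) (t : tree) :
  cat_prob R (tree_size t) <= tree_prob R t /\
  (tree_prob R t = cat_prob R (tree_size t) ->
    tree_iso t (caterpillar (tree_size t))).
Proof.
elim: t => [|l [lel isol] r [ler isor]] /=.
  split; last by move=> _; exact: iso_leaf.
  by rewrite -(tree_prob_caterpillar R 0).
have l0 := tree_size_gt0 l; have r0 := tree_size_gt0 r.
have s0 := split_pmf_gt0 R _ _ l0 r0.
have cl0 := cat_prob_gt0 R _ l0; have cr0 := cat_prob_gt0 R _ r0.
have [le eq] := cat_probD_le R _ _ l0 r0.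
have le' : split_pmf (tree_size l + tree_size r) (tree_size l) *
    (cat_prob R (tree_size l) * cat_prob R (tree_size r)) <=
    split_pmf (tree_size l + tree_size r) (tree_size l) *
    (tree_prob R l * tree_prob R r).
  by rewrite ler_pM2l// ler_pM// ltW.
split; first exact: le_trans le'.
(* Equality at the root collapses the chain of two inequalities, so [cat_probD_le] is in its
   equality case and one child has size 1. *)
move=> Peq; move: eq; rewrite eq_le le -Peq le' => /esym /orP ll.
have {le' Peq} : tree_prob R l * tree_prob R r =
   cat_prob R (tree_size l) * cat_prob R (tree_size r).
  apply: (mulfI (lt0r_neq0 s0)); apply/eqP; rewrite eq_le le' andbT Peq//.
(* The leaf contributes probability 1 to both products, so the other child attains its own bound and
   is a caterpillar up to order. A leaf on the right is handled by a swap. *)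
case: ll => /eqP /tree_size_eq1 tE; rewrite tE /= in isol isor *.
- rewrite -(tree_prob_caterpillar R 0) !mul1r => /isor; rewrite add1n.
  by case: (tree_size r) r0 => // n _; apply: iso_node iso_leaf.
- rewrite -(tree_prob_caterpillar R 0) !mulr1 => /isol; rewrite addn1.
  by case: (tree_size l) l0 => // n _ iso; apply: iso_swap => //; exact: iso_leaf.
Qed.

Lemma minimal_tree (R : realType) (k : nat) (T : tree) : tree_size T = k ->
  ((forall T' : tree, tree_size T' = k -> tree_prob R T <= tree_prob R T')
   <-> tree_iso T (caterpillar k)).
Proof.
move=> Tk; have [leT isoT] := tree_prob_ge R T; rewrite Tk in leT isoT.
have k0 : (0 < k)%N by rewrite -Tk tree_size_gt0.
have [catk Pcat] : tree_size (caterpillar k) = k /\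
    tree_prob R (caterpillar k) = cat_prob R k.
  by case: k k0 {Tk leT isoT} => // k _;
    rewrite tree_size_caterpillar tree_prob_caterpillar.
split=> [Tmin|/(tree_iso_prob R _ _)[_ ->] T' T'k].
  by apply: isoT; apply/eqP; rewrite eq_le leT andbT -Pcat Tmin.
by rewrite Pcat -T'k; case: (tree_prob_ge R T').
Qed.

(** * Asymptotics of the caterpillar probability *)

Lemma ln_le_harmonic_sum (R : realType) (n : nat) :
  ln (n.+1%:R : R) <= harmonic_sum R n.
Proof.
elim: n => [|n IH]; first by rewrite ln1 harmonic_sum_ge0.
have -> : n.+2%:R = n.+1%:R * (1 + n.+1%:R^-1) :> R.
  by rewrite mulrDr mulfV// mulr1 natr1.
rewrite lnM ?posrE ?addr_gt0 ?invr_gt0// harmonic_sumS lerD// le_ln1Dx//.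
by rewrite (@lt_trans _ _ 0)// ?ltrN10// invr_gt0.
Qed.

(** The increment of the logarithm from [n+1] to [n+2] is [-ln (1 - 1/(n+2))], which is at least
    [1/(n+2)]. *)
Lemma harmonic_sum_le_ln (R : realType) (n : nat) :
  harmonic_sum R n.+1 <= 1 + ln (n.+1%:R : R).
Proof.
elim: n => [|n IH]; first by rewrite /harmonic_sum big_nat1 invr1 ln1 addr0.
rewrite harmonic_sumS (le_trans (lerD IH (lexx _)))// -addrA lerD2l.
have n2 : 0 < n.+2%:R^-1 :> R by rewrite invr_gt0.
have n1 : n.+2%:R^-1 < 1 :> R by rewrite invf_lt1// ltr1n.
have -> : n.+1%:R = n.+2%:R * (1 - n.+2%:R^-1) :> R.
  by rewrite mulrBr mulfV// mulr1 -[in RHS]natr1 addrK.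
rewrite lnM ?posrE ?subr_gt0// -addrA gerDl -lerBrDr sub0r le_ln1Dx//.
by rewrite ltrN2.
Qed.

Lemma harmonic_sum_ge1 (R : realType) (n : nat) : 1 <= harmonic_sum R n.+1.
Proof.
rewrite (le_trans _ (@ler_harmonic_sum R 1 _ _))//.
by rewrite /harmonic_sum big_nat1 invr1.
Qed.

(** The factors with [j <= s] are dropped, being at least 1; each of the [n] others is at least
    [h_(s+1)]. *)
Lemma harmonic_prod_lower (R : realType) (s n : nat) :
  harmonic_sum R s.+1 ^+ n <= harmonic_prod R (s.+1 + n).
Proof.
elim: n => [|n IH].
  rewrite expr0 addn0; elim: s => [|s IH]; first by rewrite harmonic_prod1.
  by rewrite harmonic_prodS mulr_ege1// harmonic_sum_ge1.
rewrite addSn addnS harmonic_prodS exprSr; apply: ler_pM => //.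
- by rewrite exprn_ge0// harmonic_sum_ge0.
- exact: harmonic_sum_ge0.
- by rewrite ler_harmonic_sum// ltnS leq_addr.
Qed.

Lemma harmonic_prod_upper (R : realType) (n : nat) :
  harmonic_prod R n.+1 <= harmonic_sum R n ^+ n.
Proof.
elim: n => [|n IH]; first by rewrite harmonic_prod1 expr0.
rewrite harmonic_prodS exprSr ler_pM2r ?harmonic_sum_gt0// (le_trans IH)//.
by rewrite lerXn2r ?nnegrE ?harmonic_sum_ge0// ler_harmonic_sum.
Qed.

(** The hypothesis expresses that [x] is large in all the estimates below. The default value 0 of
    [ln] at nonpositive arguments rules these out as well. *)
Lemma lnln_ge1 (R : realType) (x : R) : 1 <= ln (ln x) ->
  [/\ 1 <= ln x, 1 <= x & ln (ln x) <= ln x].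
Proof.
move=> L1; have l1 : 1 <= ln x.
  have [//|l1] := leP 1 (ln x).
  by move: L1; rewrite leNgt (le_lt_trans (ln_le0 (ltW l1))).
have x1 : 1 <= x.
  have [//|x1] := leP 1 x.
  by move: l1; rewrite leNgt (le_lt_trans (ln_le0 (ltW x1))).
by split=> //; rewrite ltW// ln_sublinear// (lt_le_trans ltr01).
Qed.

Lemma ln_harmonic_prod_upper (R : realType) (k : nat) :
  1 <= ln (ln (k%:R : R)) ->
  ln (harmonic_prod R k) <= k%:R * (ln (ln k%:R) + 1).
Proof.
move=> /[dup] L1 /lnln_ge1[l1 k1 _].
case: k => [|n] in L1 l1 k1 *; first by rewrite ler10 in k1.
set l := ln n.+1%:R in L1 l1 *.
have l0 : 0 < l by rewrite (lt_le_trans ltr01).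
have hl : harmonic_prod R n.+1 <= (1 + l) ^+ n.+1.
  (* One more factor, at least 1, is appended so that both the exponent and the index of the
     harmonic number become [k = n+1]. *)
  rewrite (@le_trans _ _ (harmonic_prod R n.+2))//.
    by rewrite harmonic_prodS ler_peMr ?harmonic_sum_ge1// ltW// harmonic_prod_gt0.
  rewrite (le_trans (harmonic_prod_upper R n.+1))//.
  by rewrite lerXn2r ?nnegrE ?harmonic_sum_ge0 ?addr_ge0 ?harmonic_sum_le_ln// ltW.
rewrite (@le_trans _ _ (ln ((1 + l) ^+ n.+1)))//.
  by rewrite ler_ln ?posrE ?harmonic_prod_gt0 ?exprn_gt0// addr_gt0.
rewrite lnXn ?addr_gt0// -[ln _ *+ _]mulr_natl ler_wpM2l//.
have -> : 1 + l = l * (1 + l^-1) by rewrite mulrDr mulfV ?gt_eqF// mulr1 addrC.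
rewrite lnM ?posrE ?addr_gt0 ?invr_gt0// lerD2l.
by rewrite (le_trans (le_ln1Dx _))// ?invf_le1// (@lt_trans _ _ 0)// ?ltrN10 ?invr_gt0.
Qed.

Lemma ln2_le1 (R : realType) : ln (2 : R) <= 1.
Proof. by rewrite (_ : 2 = 1 + 1)// le_ln1Dx// (@lt_trans _ _ 0)// ltrN10. Qed.

Lemma ln_harmonic_prod_lower (R : realType) (k : nat) :
  1 <= ln (ln (k%:R : R)) ->
  k%:R * (ln (ln k%:R) - 3) <= ln (harmonic_prod R k).
Proof.
move=> /[dup] L1 /lnln_ge1[l1 k1 Ll].
set x : R := k%:R in L1 l1 k1 Ll *; set l := ln x in L1 l1 Ll *.
set L := ln l in L1 Ll *.
have x0 : 0 < x by rewrite (lt_le_trans ltr01).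
have l0 : 0 < l by rewrite (lt_le_trans ltr01).
pose q := Num.sqrt x.
have q2 : q ^+ 2 = x by rewrite sqr_sqrtr// ltW.
have q0 : 0 < q by rewrite sqrtr_gt0.
have lq : l = ln q *+ 2 by rewrite /l -q2 lnXn.
(* Cutting at the square root costs few factors, yet [ln q] is still half of [ln k]. *)
pose s := Num.truncn q.
have /andP[sq qs] := truncn_itv (ltW q0).
have q1 : 1 <= q by rewrite -sqrtr1 ler_wsqrtr.
have s0 : (0 < s)%N by rewrite truncn_gt0.
have sk : (s <= k)%N.
  by rewrite -(ler_nat R) (le_trans sq)// -/x -q2 expr2 ler_peMr// ltW.
have h0 : 0 < harmonic_sum R s by rewrite harmonic_sum_gt0.
have hs : L - 1 <= ln (harmonic_sum R s).
  (* Here [h_s >= ln (s+1) >= ln q = l/2]; taking logarithms loses [ln 2 <= 1]. *)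
  have l2 : l / 2 <= harmonic_sum R s.
    apply: le_trans (ln_le_harmonic_sum R s).
    rewrite lq -[_ *+ 2]mulr_natr mulfK// ler_ln ?posrE// ltW//.
  apply: (@le_trans _ _ (ln (l / 2))); last by rewrite ler_ln ?posrE// divr_gt0.
  by rewrite ln_div ?posrE// lerD2l lerN2 ln2_le1.
have lower : (k - s)%:R * ln (harmonic_sum R s) <= ln (harmonic_prod R k).
  rewrite mulr_natl -lnXn// ler_ln ?posrE ?exprn_gt0 ?harmonic_prod_gt0//.
  case: s s0 sk {sq qs h0 hs} => // s _ sk.
  by rewrite (le_trans (harmonic_prod_lower R s _))// subnKC.
apply: le_trans lower; apply: (@le_trans _ _ ((k - s)%:R * (L - 1))); last first.
  by rewrite ler_wpM2l.
rewrite natrB// -/x.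
(* From [L <= l = 2 ln q <= 2 q]. The omitted factors thus cost at most [2 k], which with the [k]
   lost through [L - 1] gives the constant 3. *)
have qL : q * L <= 2 * x.
  rewrite -q2 expr2 mulrCA ler_pM2l// (le_trans Ll)// lq -[_ *+ 2]mulr_natl ler_pM2l//.
  by rewrite ltW// ln_sublinear.
have sL : s%:R * L <= q * L by rewrite ler_wpM2r// (le_trans _ L1).
have : 0 <= s%:R :> R by [].
by nra.
Qed.

(** The constant 4 is 3 from [ln_harmonic_prod_lower] plus 1 from [ln k <= k]. The other direction
    loses only [2 k], from [ln_harmonic_prod_upper] and the power of 2. *)
Lemma ln_cat_prob (R : realType) (k : nat) : 1 <= ln (ln (k%:R : R)) ->
  `|ln (cat_prob R k) + k%:R * ln (ln k%:R)| <= 4 * k%:R.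
Proof.
move=> /[dup] L1 /lnln_ge1[l1 k1 Ll].
have hu := ln_harmonic_prod_upper R k L1.
have hl := ln_harmonic_prod_lower R k L1.
have k0 : 0 < k%:R :> R by rewrite (lt_le_trans ltr01).
rewrite cat_probE ln_div ?posrE ?mulr_gt0 ?exprn_gt0 ?harmonic_prod_gt0//.
rewrite lnM ?posrE ?exprn_gt0 ?harmonic_prod_gt0// lnXn// -[ln _ *+ _]mulr_natl.
have lk := ln_sublinear k0.
have kk : (k.-1)%:R <= k%:R :> R by rewrite ler_nat leq_pred.
have ln20 : 0 <= ln (2 : R) by rewrite ln_ge0// ler1n.
have := ln2_le1 R.
have : k.-1%:R * ln 2 <= k%:R * 1 :> R by rewrite ler_pM// ln2_le1.
have : 0 <= k.-1%:R * ln 2 :> R by rewrite mulr_ge0.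
rewrite ler_norml; lra.
Qed.

Theorem lemma2p4 (R : realType) :
  (forall k : nat, (0 < k)%N ->
    (forall T : tree, tree_size T = k ->
      ((forall T' : tree, tree_size T' = k ->
          (dtcs k [set T] <= dtcs k [set T'] :> \bar R)%E)
       <-> tree_iso T (caterpillar k))) /\
    dtcs k [set caterpillar k] =
      (k%:R * 2 ^- k.-1 *
         \prod_(2 <= i < k.+1) (harmonic_sum R i.-1)^-1)%:E) /\
  (exists eps : nat -> R,
    eps @ \oo --> (0 : R) /\
    \forall k \near \oo,
      dtcs k [set caterpillar k] =
        (expR (- ((1 + eps k) * (k%:R * ln (ln k%:R)))))%:E).
Proof.
have dtcsE k T : (0 < k)%N -> tree_size T = k ->
    dtcs (R := R) k [set T] = (tree_prob R T)%:E.
  by move=> k0 Tk; rewrite /dtcs dtcs_rec_set1// Tk eqxx.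
have dtcs_cat k : (0 < k)%N ->
    dtcs (R := R) k [set caterpillar k] = (cat_prob R k)%:E.
  case: k => // k k0.
  by rewrite dtcsE ?tree_size_caterpillar// tree_prob_caterpillar.
split=> [k k0|].
  split=> [T Tk|]; last exact: dtcs_cat.
  rewrite -(minimal_tree R k T Tk); split=> min T' T'k.
    by rewrite -lee_fin -(dtcsE k)// -(dtcsE k)// min.
  by rewrite !dtcsE// lee_fin min.
pose L (k : nat) : R := ln (ln k%:R).
have L_ge A : \forall k \near \oo, A <= L k.
  near=> k.
  have kA : expR (expR A) <= k%:R by near: k; exact: nbhs_infty_ger.
  have lA : expR A <= ln k%:R.
    by rewrite -[leLHS]expRK ler_ln ?posrE ?expR_gt0// (lt_le_trans _ kA) ?expR_gt0.
  by rewrite -[leLHS]expRK ler_ln ?posrE ?expR_gt0// (lt_le_trans _ lA) ?expR_gt0.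
(* The error term is obtained by solving the claimed identity for it, so the identity holds as soon
   as [k * L k] is nonzero; convergence to 0 is the real content. *)
exists (fun k => - ln (cat_prob R k) / (k%:R * L k) - 1); split; last first.
  near=> k.
  have L1 : 1 <= L k by near: k; exact: L_ge.
  have [_ k1 _] := lnln_ge1 _ _ L1.
  have k0 : (0 < k)%N by rewrite -(ltr_nat R) (lt_le_trans ltr01).
  rewrite dtcs_cat// addrC subrK divfK ?opprK ?lnK ?posrE ?cat_prob_gt0//.
  by rewrite mulf_neq0// gt_eqF ?ltr0n// (lt_le_trans ltr01).
apply/cvgr0Pnorm_le => e e0; near=> k.
have L1 : 1 <= L k by near: k; exact: L_ge.
(* By [ln_cat_prob] the error term is at most [4 / L k] in absolute value. *)
have Le : 4 / e <= L k by near: k; exact: L_ge.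
have [_ k1 _] := lnln_ge1 _ _ L1.
have k0 : 0 < k%:R :> R by rewrite (lt_le_trans ltr01).
have L0 : 0 < L k by rewrite (lt_le_trans ltr01).
have kL0 : 0 < k%:R * L k by rewrite mulr_gt0.
(* The 1 is written as [k * L k] over itself, to make a single fraction whose numerator
   [ln_cat_prob] bounds. *)
rewrite -[X in _ - X](mulfV (lt0r_neq0 kL0)) -mulrBl -opprD mulNr normrN normrM.
rewrite [`|_^-1|]gtr0_norm ?invr_gt0// ler_pdivrMr// (le_trans (ln_cat_prob R k L1))//.
by rewrite mulrCA [leLHS]mulrC ler_pM2l// mulrC -ler_pdivrMr.
Unshelve. all: end_near. Qed.
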